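(* For each fixed integer $\alpha$, the function $F\mapsto T(F,F-\alpha)$ is constant for all sufficiently large integers $F$, and the function $g\mapsto L(g,g-\alpha)$ is constant for all sufficiently large integers $g$. Here $T(F,t)$ is the number of numerical semigroups with Frobenius number $F$ and type $t$, and $L(g,t)$ is the number of numerical semigroups with genus $g$ and type $t$.
   Context: $\mathbb{N}=\{0,1,2,\dots\}$. A numerical semigroup is a subset $S\subseteq\mathbb{N}$ containing $0$, closed under addition, with finite complement in $\mathbb{N}$. The elements of $\mathbb{N}\setminus S$ are the gaps of $S$; the genus $g(S)$ is the number of gaps; for $S\neq\mathbb{N}$ the Frobenius number $F(S)$ is the largest gap. The set of pseudo-Frobenius numbers is $PF(S)=\{x\in\mathbb{N}\setminus S \mid x+s\in S \text{ for all } s\in S\setminus\{0\}\}$, and the type is $t(S)=|PF(S)|$. *)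

(* Defs.v *)
From mathcomp Require Import all_boot all_order all_algebra finmap.
From mathcomp Require Import all_classical.

Set Implicit Arguments.
Unset Strict Implicit.
Unset Printing Implicit Defensive.

Import Order.TTheory GRing.Theory Num.Theory.

Local Open Scope classical_set_scope.
Local Open Scope nat_scope.

Definition numerical_semigroup (S : set nat) : Prop :=
  [/\ S 0, (forall a b, S a -> S b -> S (a + b)) & finite_set (~` S)].

Definition gaps (S : set nat) : set nat := ~` S.

(* [fset_set A] is the finite set of the elements of [A] when [A] is finite,
   and a junk value otherwise; the lemmas [finite_gaps], [finite_pseudo_frobenius],
   [finite_frobenius_type_family] and [finite_genus_type_family] below show that
   the junk value never occurs. *)
Definition genus (S : set nat) : nat := #|` fset_set (gaps S)|.

(* A relation, because the Frobenius number of [setT] is undefined. *)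
Definition is_frobenius (S : set nat) (f : nat) : Prop :=
  gaps S f /\ forall x, gaps S x -> x <= f.

Definition pseudo_frobenius (S : set nat) : set nat :=
  [set x | ~ S x /\ forall s, S s -> s <> 0 -> S (x + s)].

Definition semigroup_type (S : set nat) : nat :=
  #|` fset_set (pseudo_frobenius S)|.

Definition frobenius_type_family (F t : int) : set (set nat) :=
  [set S | [/\ numerical_semigroup S,
               exists2 f : nat, is_frobenius S f & Posz f = F
             & Posz (semigroup_type S) = t]].

Definition genus_type_family (g t : int) : set (set nat) :=
  [set S | [/\ numerical_semigroup S,
               Posz (genus S) = g
             & Posz (semigroup_type S) = t]].

Definition count_frobenius_type (F t : int) : nat :=
  #|` fset_set (frobenius_type_family F t)|.

Definition count_genus_type (g t : int) : nat :=
  #|` fset_set (genus_type_family g t)|.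

Lemma finite_gaps (S : set nat) : numerical_semigroup S -> finite_set (gaps S).
Proof. by case. Qed.

Lemma finite_pseudo_frobenius (S : set nat) :
  numerical_semigroup S -> finite_set (pseudo_frobenius S).
Proof. by move=> /finite_gaps; apply: sub_finite_set => x []. Qed.

Lemma finite_bounded_gaps (n : nat) :
  finite_set [set S : set nat | forall x, gaps S x -> x < n].
Proof.
pose h (A : {set 'I_n}) : set nat := [set x | forall i : 'I_n, val i = x -> i \in A].
apply: (@sub_finite_set _ _ (h @` setT)); last exact/finite_image/finite_finset.
move=> S Sn; exists [set i : 'I_n | `[< S (val i) >]]%SET => //.
apply/seteqP; split=> x /=.
  move=> hx; apply: contrapT => Sx; have xn := Sn x Sx.
  by have := hx (Ordinal xn) erefl; rewrite inE => /asboolP.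
by move=> Sx i ix; rewrite inE ix; apply/asboolP.
Qed.

Lemma finite_frobenius_type_family (F t : int) :
  finite_set (frobenius_type_family F t).
Proof.
apply: sub_finite_set (finite_bounded_gaps `|F|.+1) => S [_ [f [_ Sf] <-] _] x.
by move=> /Sf; rewrite absz_nat ltnS.
Qed.

Lemma gap_lt_genus (S : set nat) (n : nat) :
  numerical_semigroup S -> gaps S n -> n < (genus S).*2.
Proof.
move=> nS Sn; have [_ SD _] := nS; have fS := finite_gaps nS.
pose G := fset_set (gaps S).
have inG x : (x \in G) = `[< ~ S x >].
  by rewrite in_fset_set//; apply/idP/asboolP; rewrite inE.
pose H := (G `|` [fset n - x | x in G])%fset.
have sub : {subset iota 0 n.+1 <= H}.
  move=> x; rewrite mem_iota add0n /= ltnS => xn; rewrite in_fsetU inG.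
  have [//|Sx] := asboolP (~ S x); rewrite orFb.
  apply/imfsetP; exists (n - x) => /=; last by rewrite subKn.
  rewrite inG; apply/asboolP => Snx; apply: Sn.
  by rewrite -(subnKC xn); apply: SD => //; apply: contrapT.
have nH : n < #|` H|.
  by rewrite -(size_iota 0 n.+1); apply: uniq_leq_size (iota_uniq _ _) sub.
have imG : #|` [fset n - x | x in G]%fset| <= #|` G| by exact: leq_imfset_card.
apply: leq_trans nH _; rewrite -addnn.
apply: leq_trans (leq_add (leqnn _) imG).
by rewrite -cardfsUI leq_addr.
Qed.

Lemma finite_genus_type_family (g t : int) :
  finite_set (genus_type_family g t).
Proof.
apply: sub_finite_set (finite_bounded_gaps `|g|.*2) => S [nS <- _] x Sx.
by rewrite absz_nat; exact: gap_lt_genus.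
Qed.

(* Main.v *)
Require Import Defs.
From mathcomp Require Import all_boot all_order all_algebra.
From mathcomp Require Import finmap all_classical zify.

(** Reflect a semigroup [S] with Frobenius number [f] at [f]: it is determined by
    [f] and the finite set [B] of all [f - s] with [s] in [S] and [0 < s < f].
    The genus is [f - #|B|], and a gap [x] fails to be pseudo-Frobenius iff
    [x <= b] and [b - x] is not in [B] for some [b] in [B]; the set [defects B] of
    these [x] does not depend on [f].  Fixing [F - t] (resp. [g - t]) therefore
    fixes [#|B| + #|defects B|] (resp. [#|defects B|]).  Since [B] is included in
    [defects B], and since each [x] in [[1, max B]] is in [defects B] or has
    [max B - x] in [B], these quantities bound [max B].  Conversely, if
    [2 * max B < f], any two positive elements of [S] add up to more than [f], so
    every such [B] occurs. *)

Set Implicit Arguments.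
Unset Strict Implicit.
Unset Printing Implicit Defensive.

Import Order.TTheory GRing.Theory Num.Theory.

Local Open Scope fset_scope.
Local Open Scope nat_scope.

(** Subtraction is truncated, so [f - x] is [0] for all [x >= f]: the clause [f < x] admits the
    large numbers, and for [0 < f] the number [f] is a gap iff [0] is not in [B]. *)
Definition reflected_set (f : nat) (B : {fset nat}) : set nat :=
  [set x | [|| x == 0, f < x | f - x \in B]]%classic.

Definition defects (B : {fset nat}) : {fset nat} :=
  [fset x in iota 1 (\max_(b <- B) b) | has (fun b => (x <= b) && (b - x \notin B)) B].

Lemma in_defects (B : {fset nat}) (x : nat) :
  reflect (exists2 b, b \in B & [&& 0 < x, x <= b & b - x \notin B])
          (x \in defects B).
Proof.
rewrite !inE /= mem_iota; apply: (iffP andP) => [[/andP[x0 _] /hasP[b bB xb]]|].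
  by exists b => //; rewrite x0.
case=> b bB /and3P[x0 xb bx]; split; last by apply/hasP; exists b; rewrite ?xb.
by rewrite x0 add1n ltnS (leq_trans xb)// leq_bigmax_seq.
Qed.

(** Each [b] in [B] is a defect witnessed by itself, as [b - b = 0] is not in [B]. *)
Lemma card_le_defects (B : {fset nat}) :
  {in B, forall b, 0 < b} -> #|` B| <= #|` defects B|.
Proof.
move=> B0; apply/fsubset_leq_card/fsubsetP => b bB; apply/in_defects; exists b => //.
by rewrite B0// leqnn subnn; apply/negP => /B0.
Qed.

Lemma bound_card_defects (B : {fset nat}) (b : nat) :
  b \in B -> b <= #|` B| + #|` defects B|.
Proof.
move=> bB; pose C := [fset b - c | c in B].
have sub : {subset iota 1 b <= C `|` defects B}.
  move=> x; rewrite mem_iota add1n ltnS => /andP[x0 xb]; rewrite in_fsetU.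
  have [bxB|bxB] := boolP (b - x \in B).
    by apply/orP; left; apply/imfsetP; exists (b - x); rewrite //= subKn.
  by apply/orP; right; apply/in_defects; exists b; rewrite // x0 xb.
have := uniq_leq_size (iota_uniq _ _) sub; rewrite size_iota => /leq_trans; apply.
apply: leq_trans (leq_addr #|` C `&` defects B| _) _.
by rewrite cardfsUI leq_add2r leq_imfset_card.
Qed.

Lemma reflected_set_exists (S : set nat) (f : nat) :
  numerical_semigroup S -> is_frobenius S f ->
  exists2 B : {fset nat}, {in B, forall b, 0 < b < f} & S = reflected_set f B.
Proof.
move=> [S0 _ _] [Sf maxf].
(* The range stops at [f - 1]: the reflection [f] of the element [0] is left out, since
   [reflected_set] has a clause of its own for [0]. *)
exists [fset b in iota 1 f.-1 | `[< S (f - b) >]].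
  by move=> b; rewrite !inE mem_iota => /andP[/andP[] + + _]; lia.
have f0 : 0 < f by case: f Sf {maxf}.
apply/seteqP; split=> x; rewrite /reflected_set /= !inE mem_iota.
  move=> Sx; have [->//|x0] := posnP x; have [//|xf] := ltnP f x.
  have xNf : x != f by apply/eqP => xf'; apply: Sf; rewrite -xf'.
  rewrite subKn// asboolT// andbT; apply/orP; right; lia.
case/or3P => [/eqP->//|fx|/andP[xf /asboolP]]; last by rewrite subKn//; lia.
by apply: contrapT => /maxf; rewrite leqNgt fx.
Qed.

(** For [0 < b < f], the point [f - b] lies strictly between [0] and [f], where membership is
    decided by [b \in B] alone. *)
Lemma reflected_set_inj (f : nat) (B C : {fset nat}) :
  {in B, forall b, 0 < b < f} -> {in C, forall c, 0 < c < f} ->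
  reflected_set f B = reflected_set f C -> B = C.
Proof.
move=> Bf Cf eBC.
have sub (D E : {fset nat}) : {in D, forall b, 0 < b < f} ->
    reflected_set f D = reflected_set f E -> D `<=` E.
  move=> Df eDE; apply/fsubsetP => b bD; have /andP[b0 bf] := Df _ bD.
  have : reflected_set f D (f - b) by rewrite /reflected_set /= subKn ?bD ?orbT// ltnW.
  by rewrite eDE /reflected_set /= subKn ?(ltnW bf)// => /or3P[||//]; lia.
by apply/eqP; rewrite eqEfsubset !sub.
Qed.

Lemma is_frobenius_reflected_set (f : nat) (B : {fset nat}) :
  0 < f -> {in B, forall b, 0 < b} -> is_frobenius (reflected_set f B) f.
Proof.
move=> f0 B0; split; rewrite /gaps /reflected_set /=.
  by rewrite subnn ltnn => /or3P[|//|/B0//]; lia.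
by move=> x /negP; rewrite !negb_or -leqNgt => /and3P[].
Qed.

Lemma is_frobenius_unique (S : set nat) (f f' : nat) :
  is_frobenius S f -> is_frobenius S f' -> f = f'.
Proof. by move=> [Sf mf] [Sf' mf']; apply/eqP; rewrite eqn_leq mf ?mf'. Qed.

Lemma is_frobenius_exists (S : set nat) :
  numerical_semigroup S -> 0 < genus S -> exists f, is_frobenius S f.
Proof.
move=> nS; have fS := finite_gaps nS.
rewrite cardfs_gt0 => /fset0Pn[x]; rewrite in_fset_set// inE => Sx.
have ex : exists n, `[< gaps S n >] by exists x; apply/asboolP.
have ub n : `[< gaps S n >] -> n <= (genus S).*2.
  by move=> /asboolP Sn; exact/ltnW/gap_lt_genus.
case: (ex_maxnP ex ub) => f /asboolP Sf maxf; exists f; split=> // y Sy.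
exact/maxf/asboolP.
Qed.

Lemma numerical_semigroup_reflected_set (f K : nat) (B : {fset nat}) :
  K.*2 < f -> {in B, forall b, 0 < b <= K} ->
  numerical_semigroup (reflected_set f B).
Proof.
move=> Kf BK; split; first by [].
  move=> a b; rewrite /reflected_set /=.
  (* A positive element is above [f] or equals [f - b] with [b <= K < f / 2]; either way its double
     exceeds [f]. *)
  have big x : [|| x == 0, f < x | f - x \in B] -> (x == 0) || (f < x.*2).
    by case/or3P => [->//|fx|/BK]; lia.
  have [->//|a0] := eqVneq a 0; have [->|b0] := eqVneq b 0; first by rewrite addn0 (negPf a0).
  move=> ha hb; suff -> : f < a + b by rewrite orbT.
  by have := big a; have := big b; rewrite (negPf a0) (negPf b0) /= => /(_ hb) + /(_ ha); lia.
apply: (@sub_finite_set _ _ (`I_f.+1)%classic); last exact: finite_II.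
by move=> x /= /negP; rewrite !negb_or -leqNgt ltnS => /and3P[].
Qed.

(** The gaps are [[1, f]] minus the reflection [C] of [B], and reflecting is injective below [f]. *)
Lemma genus_reflected_set (f : nat) (B : {fset nat}) :
  numerical_semigroup (reflected_set f B) -> {in B, forall b, 0 < b < f} ->
  genus (reflected_set f B) + #|` B| = f.
Proof.
move=> nS Bf; have fS := finite_gaps nS; rewrite /genus.
pose I := [fset x in iota 1 f]; pose C := [fset f - b | b in B].
have <- : #|` C| = #|` B|.
  apply: card_in_imfset => b c /Bf bf /Bf cf /=; lia.
have CI : C `<=` I.
  apply/fsubsetP => x /imfsetP[b /Bf bf ->]; rewrite !inE mem_iota; lia.
have -> : fset_set (gaps (reflected_set f B)) = I `\` C.
  apply/fsetP => x; rewrite in_fset_set// in_fsetD; apply/idP/idP.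
    rewrite inE /gaps /reflected_set /= => /negP; rewrite !negb_or => /and3P[x0 xf xB].
    rewrite !inE mem_iota; apply/andP; split; last by lia.
    by apply/imfsetP => -[b bB xE]; move: xB; rewrite xE subKn ?bB//; have := Bf _ bB; lia.
  move=> /andP[xC]; rewrite !inE mem_iota => xf; rewrite /gaps /reflected_set /=.
  move=> /or3P[||fxB]; [lia|lia|].
  by move/negP: xC; apply; apply/imfsetP; exists (f - x); rewrite //= subKn//; lia.
rewrite cardfsD (fsetIidPr CI) subnK ?fsubset_leq_card//.
by rewrite card_fseq undup_id ?iota_uniq// size_iota.
Qed.

Lemma type_reflected_set (f : nat) (B : {fset nat}) :
  numerical_semigroup (reflected_set f B) -> {in B, forall b, 0 < b < f} ->
  semigroup_type (reflected_set f B) + #|` defects B| = genus (reflected_set f B).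
Proof.
move=> nS Bf; have fS := finite_gaps nS; have fP := finite_pseudo_frobenius nS.
have [_ SD _] := nS.
rewrite /genus /semigroup_type; set S := reflected_set f B in nS fS fP SD *.
have SB b : b \in B -> S (f - b).
  move=> bB; have /andP[_ bf] := Bf _ bB.
  by rewrite /S /reflected_set /= subKn ?bB ?orbT// ltnW.
(* The element [f - b] moves [x] to the reflection of [b - x], hence out of [S]. *)
have shift b x : b \in B -> x <= b -> b - x \notin B -> ~ S (x + (f - b)).
  move=> bB xb bx; have := Bf _ bB; rewrite /S /reflected_set /= => bf.
  have -> : f - (x + (f - b)) = b - x by lia.
  by rewrite (negPf bx); lia.
(* A defect in [S] would contradict closure under addition, by [shift]. *)
have DG : defects B `<=` fset_set (gaps S).
  apply/fsubsetP => x /in_defects[b bB /and3P[x0 xb bx]]; rewrite in_fset_set// inE.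
  by move=> Sx; apply: (shift b x bB xb bx); apply: SD => //; exact: SB.
suff -> : fset_set (pseudo_frobenius S) = fset_set (gaps S) `\` defects B.
  by rewrite cardfsD (fsetIidPr DG) subnK// fsubset_leq_card.
apply/fsetP => x; rewrite in_fsetD !in_fset_set//; apply/idP/andP.
  rewrite inE => -[Sx PFx]; split; last by rewrite inE.
  apply/in_defects => -[b bB /and3P[x0 xb bx]]; apply: (shift b x bB xb bx).
  by apply: PFx; [exact: SB|have := Bf _ bB; lia].
move=> [/in_defects xD]; rewrite !inE => Sx; split=> // s Ss s0.
(* If [x + s] is a gap then [x + s <= f], so [s < f] and [b = f - s] lies in [B]; it witnesses that
   [x] is a defect. *)
apply: contrapT => Sxs; apply: xD.
move: Ss Sxs Sx; rewrite /gaps /S /reflected_set /= => Ss /negP + /negP.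
rewrite !negb_or => /and3P[xs0 xsf xsB] /and3P[x0 _ _].
have fsB : f - s \in B by move: Ss => /or3P[||//]; lia.
exists (f - s) => //; apply/and3P; split; [lia|lia|].
by have -> : f - s - x = f - (x + s) by lia.
Qed.

Lemma card_fset_set_image (T U : choiceType) (h : T -> U) (X : {fset T})
    (A : set U) :
  {in X &, injective h} -> (A = h @` [set` X])%classic -> #|` fset_set A| = #|` X|.
Proof.
move=> hinj ->; rewrite fset_set_image; last exact: finite_fset.
by rewrite set_fsetK card_in_imfset.
Qed.

Definition bounded_positive_sets (K : nat) : {fset {fset nat}} :=
  fpowerset [fset x in iota 1 K].

Lemma bounded_positive_setsP (K : nat) (B : {fset nat}) :
  reflect {in B, forall b, 0 < b <= K} (B \in bounded_positive_sets K).
Proof.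
rewrite fpowersetE; apply: (iffP (@fsubsetP _ _ _)) => BK b bB.
  by have := BK _ bB; rewrite !inE mem_iota add1n ltnS.
by rewrite !inE mem_iota add1n ltnS BK.
Qed.

(** The right-hand side is free of [f], so it is the eventual value. [bound_card_defects] bounds the
    elements of [B] by [alpha], and the hypothesis on [f] makes every such [B] yield a semigroup. *)
Lemma count_frobenius_typeE (alpha : int) (f : nat) :
  (`|alpha|.*2 < f)%N ->
  count_frobenius_type f (Posz f - alpha)%R =
  #|` [fset B in bounded_positive_sets `|alpha|
        | Posz (#|` B| + #|` defects B|) == alpha]|.
Proof.
move=> Kf; apply: (@card_fset_set_image _ _ (reflected_set f)).
  move=> B C; rewrite !inE => /andP[/bounded_positive_setsP BK _].
  move=> /andP[/bounded_positive_setsP CK _]; apply: reflected_set_inj.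
    by move=> b /BK; lia.
  by move=> b /CK; lia.
apply/seteqP; split=> [S /=|_ [B /= + <-]].
  move=> [nS [f' fS /eqP]]; rewrite eqz_nat => /eqP ff'; subst f'.
  have [B Bf SE] := reflected_set_exists nS fS; subst S => tE.
  have := genus_reflected_set nS Bf; have := type_reflected_set nS Bf => tD gE.
  have BE : Posz (#|` B| + #|` defects B|) = alpha by lia.
  exists B => //; rewrite !inE BE eqxx andbT; apply/bounded_positive_setsP => b bB.
  by have := bound_card_defects bB; have := Bf _ bB; lia.
rewrite !inE => /andP[/bounded_positive_setsP BK /eqP BE].
have Bf : {in B, forall b, 0 < b < f} by move=> b /BK; lia.
have nS := numerical_semigroup_reflected_set Kf BK.
split=> //; last first.
  have {}BE : Posz (#|` B| + #|` defects B|) = alpha := BE.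
  by have := genus_reflected_set nS Bf; have := type_reflected_set nS Bf; lia.
by exists f => //; apply: is_frobenius_reflected_set => [|b /BK]; lia.
Qed.

(** With the genus fixed, the point of reflection [g + #|B|] varies with [B]. *)
Lemma count_genus_typeE (alpha : int) (g : nat) :
  (`|alpha|.*2.*2 < g)%N ->
  count_genus_type g (Posz g - alpha)%R =
  #|` [fset B in bounded_positive_sets `|alpha|.*2
        | Posz #|` defects B| == alpha]|.
Proof.
move=> Kg; apply: (@card_fset_set_image _ _ (fun B : {fset nat} => reflected_set (g + #|` B|) B)).
  move=> B C; rewrite !inE => /andP[/bounded_positive_setsP BK _].
  move=> /andP[/bounded_positive_setsP CK _] eBC.
  have fB : is_frobenius (reflected_set (g + #|` B|) B) (g + #|` B|).
    by apply: is_frobenius_reflected_set => [|b /BK]; lia.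
  have fC : is_frobenius (reflected_set (g + #|` C|) C) (g + #|` C|).
    by apply: is_frobenius_reflected_set => [|b /CK]; lia.
  (* Equal semigroups share their Frobenius number, so both sets are reflected at the same point. *)
  rewrite eBC in fB; have fE := is_frobenius_unique fB fC; rewrite fE in eBC.
  apply: reflected_set_inj eBC; first by move=> b /BK; lia.
  by move=> b /CK; lia.
apply/seteqP; split=> [S /=|_ [B /= + <-]].
  move=> [nS gS tE]; have [|f fS] := is_frobenius_exists nS; first by lia.
  have [B Bf SE] := reflected_set_exists nS fS; subst S.
  have := genus_reflected_set nS Bf; have := type_reflected_set nS Bf => tD gE.
  have BE : Posz #|` defects B| = alpha by lia.
  have fE : g + #|` B| = f by lia.
  exists B; last by rewrite fE.
  rewrite !inE BE eqxx andbT; apply/bounded_positive_setsP => b bB.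
  (* Here [b <= #|B| + #|defects B| <= 2 * #|defects B| = 2 * alpha], whence the doubled bound. *)
  have := bound_card_defects bB; have := Bf _ bB.
  have := @card_le_defects B; have B0 : {in B, forall b, 0 < b} by move=> c /Bf/andP[].
  by move=> /(_ B0); lia.
rewrite !inE => /andP[/bounded_positive_setsP BK /eqP BE].
have Bf : {in B, forall b, 0 < b < g + #|` B|} by move=> b /BK; lia.
have nS : numerical_semigroup (reflected_set (g + #|` B|) B).
  by apply: numerical_semigroup_reflected_set BK; lia.
have {}BE : Posz #|` defects B| = alpha := BE.
have /addIn gE := genus_reflected_set nS Bf.
have := type_reflected_set nS Bf; rewrite gE => tD; split=> //; first by congr Posz.
by rewrite -BE -[in RHS]tD PoszD addrK.
Qed.

Theorem theorem1p7 (alpha : int) :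
  (exists (N : int) (c : nat), forall F : int, (N <= F)%R ->
     count_frobenius_type F (F - alpha)%R = c) /\
  (exists (N : int) (c : nat), forall g : int, (N <= g)%R ->
     count_genus_type g (g - alpha)%R = c).
Proof.
split.
  (* The threshold is positive, which rules out negative [F]; the constant is left open and is fixed
     by unification with [count_frobenius_typeE]. *)
  exists (Posz `|alpha|.*2.+1); eexists => -[f|f] Nf; last by lia.
  by apply: count_frobenius_typeE; lia.
exists (Posz `|alpha|.*2.*2.+1); eexists => -[g|g] Ng; last by lia.
by apply: count_genus_typeE; lia.
Qed.
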